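(* Fix an integer $L\ge2$, let $\mathcal{G}_L=\{0,1/L,\dots,1\}$, and fix $n\ge0$. Let $\mathcal{S}$ be any set and $R:\mathcal{G}_L^{n+1}\to\mathcal{S}$ a representation such that every $F\in\mathcal{R}$ is computable from $R(u_{0:n})$. Then there exists a computable function $\Phi:\mathcal{S}\to(\mathcal{G}_L\times\mathcal{G}_L)^*$ such that $\Phi(R(u_{0:n}))=\Pi_n(u_{0:n})$ for every $u_{0:n}\in\mathcal{G}_L^{n+1}$.
   Context: For $u=u_{0:n}\in\mathcal{G}_L^{n+1}$, the extremum stack $\Pi_n(u)$ is the list of pairs $[(M_1,m_1),\dots,(M_k,m_k)]$ (bottom to top; $(M_k,m_k)$ the current top) produced by: initialise $\Pi=\emptyset$, $e=u_0$, $d=0$; for $t=1,\dots,n$: let $d_{\mathrm{new}}=\mathrm{sign}(u_t-e)$; if $d_{\mathrm{new}}=0$ do nothing; otherwise, if $d\ne0$ and $d_{\mathrm{new}}\ne d$: if $d=+1$, set $m_{\mathrm{last}}=m_k$ (or $-\infty$ if $\Pi=\emptyset$), while $\Pi\ne\emptyset$ and $M_k<e$ set $m_{\mathrm{last}}\leftarrow m_k$ and pop, then push $(e,m_{\mathrm{last}})$; if $d=-1$, set $M_{\mathrm{last}}=M_k$ (or $+\infty$ if $\Pi=\emptyset$), while $\Pi\ne\emptyset$ and $m_k>e$ set $M_{\mathrm{last}}\leftarrow M_k$ and pop, then push $(M_{\mathrm{last}},e)$; finally set $e\leftarrow u_t$, $d\leftarrow d_{\mathrm{new}}$. (The paper describes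 the stack as having strictly decreasing maxima $M_1>\dots>M_k$ and strictly increasing minima $m_1<\dots<m_k$.) A functional $F$ assigns a real $F[u](n)$ to each $u\in\mathcal{G}_L^{n+1}$; it is rate-independent if $\Pi_n(u)=\Pi_{n'}(v)$ implies $F[u](n)=F[v](n')$ for all $u\in\mathcal{G}_L^{n+1}$, $v\in\mathcal{G}_L^{n'+1}$. $\mathcal{R}$ is the class of all computable rate-independent functionals on $\mathcal{G}_L^*$. *)

(* Defs.v *)
From mathcomp Require Import all_boot all_order all_algebra.
Set Implicit Arguments. Unset Strict Implicit. Unset Printing Implicit Defensive.

(* The grid G_L = {0, 1/L, ..., 1}: the ordinal k : 'I_(L.+1) stands for k/L.
   The map k |-> k/L is an order isomorphism, so sign(u_t - e) and all
   comparisons of the extremum-stack algorithm are computed on indices. *)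
Definition grid (L : nat) := 'I_L.+1.

(* Stack entries live in G_L extended by -oo and +oo (the algorithm pushes
   m_last = -oo resp. M_last = +oo when the stack is empty). *)
Inductive xg (L : nat) : Type :=
| XNegInf : xg L
| XPt : grid L -> xg L
| XPosInf : xg L.
Arguments XNegInf {L}.
Arguments XPosInf {L}.

Definition xrank (L : nat) (x : xg L) : nat :=
  match x with XNegInf => 0 | XPt k => (nat_of_ord k).+1 | XPosInf => L.+2 end.
Definition xlt (L : nat) (x y : xg L) : bool := (xrank x < xrank y)%N.

Inductive dir := DMinus | DZero | DPlus.
Definition dir_eqb (a b : dir) : bool :=
  match a, b with
  | DMinus, DMinus | DZero, DZero | DPlus, DPlus => true
  | _, _ => false end.

Definition sgn_diff (L : nat) (ut e : grid L) : dir :=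
  if (nat_of_ord e < nat_of_ord ut)%N then DPlus
  else if (nat_of_ord ut < nat_of_ord e)%N then DMinus else DZero.

(* Internal stack representation: the top of the stack is the HEAD of the list. *)
Definition stack (L : nat) := seq (xg L * xg L).

Fixpoint pop_max (L : nat) (st : stack L) (mlast : xg L) (e : grid L)
  : stack L * xg L :=
  match st with
  | (M, m) :: st' => if xlt M (XPt e) then pop_max st' m e else (st, mlast)
  | [::] => ([::], mlast)
  end.

Fixpoint pop_min (L : nat) (st : stack L) (Mlast : xg L) (e : grid L)
  : stack L * xg L :=
  match st with
  | (M, m) :: st' => if xlt (XPt e) m then pop_min st' M e else (st, Mlast)
  | [::] => ([::], Mlast)
  end.

Definition push_max (L : nat) (st : stack L) (e : grid L) : stack L :=
  let ml0 := match st with (_, m) :: _ => m | [::] => XNegInf end in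
  let '(st', ml) := pop_max st ml0 e in (XPt e, ml) :: st'.

Definition push_min (L : nat) (st : stack L) (e : grid L) : stack L :=
  let Ml0 := match st with (M, _) :: _ => M | [::] => XPosInf end in
  let '(st', Ml) := pop_min st Ml0 e in (Ml, XPt e) :: st'.

Definition es_step (L : nat) (s : stack L * grid L * dir) (ut : grid L)
  : stack L * grid L * dir :=
  let '(st, e, d) := s in
  let dn := sgn_diff ut e in
  match dn with
  | DZero => s
  | _ =>
    let st' :=
      if (~~ dir_eqb d DZero) && (~~ dir_eqb dn d) then
        (if dir_eqb d DPlus then push_max st e else push_min st e)
      else st in
    (st', ut, dn)
  end.

(* Extremum stack of u_0 :: rest, listed bottom to top [(M_1,m_1);...;(M_k,m_k)]. *)
Definition ext_stack_seq (L : nat) (u : seq (grid L)) : seq (xg L * xg L) :=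
  match u with
  | [::] => [::]
  | u0 :: r => let '(st, _, _) := foldl (@es_step L) ([::], u0, DZero) r in rev st
  end.

Definition ext_stack (L n : nat) (u : (n.+1).-tuple (grid L)) : seq (xg L * xg L) :=
  ext_stack_seq (val u).

Definition functional (L : nat) := forall n : nat, (n.+1).-tuple (grid L) -> rat.

Definition rate_independent (L : nat) (F : functional L) : Prop :=
  forall (n n' : nat) (u : (n.+1).-tuple (grid L)) (v : (n'.+1).-tuple (grid L)),
    ext_stack u = ext_stack v -> F n u = F n' v.

(* Main.v *)
(* The extremum stack, coded injectively by a natural number, is itself a
   rate-independent functional; its value computed from [Rep u] decodes back to
   the stack. Nothing depends on the size of the grid, so [hL] is unused. *)
From HB Require Import structures.
Require Import Defs.
From mathcomp Require Import all_boot all_order all_algebra.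

Definition xunrank (L : nat) (k : nat) : xg L :=
  if k is k'.+1 then oapp (@XPt L) XPosInf (insub k') else XNegInf.

Lemma xrankK (L : nat) : cancel (@xrank L) (@xunrank L).
Proof. by case=> [|k|] //=; rewrite ?valK ?insubN ?ltnn. Qed.

HB.instance Definition _ (L : nat) := Countable.copy (xg L) (can_type (@xrankK L)).

Lemma rate_independent_ext_stack_comp (L : nat) (f : seq (xg L * xg L) -> rat) :
  rate_independent (fun n (u : (n.+1).-tuple (grid L)) => f (ext_stack u)).
Proof. by move=> n n' u v ->. Qed.

Lemma absz_numq_natr (k : nat) : absz (numq (k%:R : rat)%R) = k.
Proof. by rewrite -[(k%:R)%R]/((Posz k)%:~R : rat)%R numq_int. Qed.

Theorem lemma2 (L : nat) (hL : (2 <= L)%N) (n : nat) (S : Type)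
  (Rep : (n.+1).-tuple (grid L) -> S)
  (HR : forall F : functional L, rate_independent F ->
        {g : S -> rat | forall u : (n.+1).-tuple (grid L), g (Rep u) = F n u}) :
  {Phi : S -> seq (xg L * xg L) |
     forall u : (n.+1).-tuple (grid L), Phi (Rep u) = ext_stack u}.
Proof.
pose code (s : seq (xg L * xg L)) : rat := ((pickle s)%:R)%R.
have [g Hg] := HR _ (@rate_independent_ext_stack_comp L code).
exists (fun s => odflt [::] (unpickle (absz (numq (g s))))) => u.
by rewrite Hg absz_numq_natr pickleK.
Qed.
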